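(* Let $n,m$ be positive integers, let $E\subset\mathbb{R}^n$ be a non-empty compact set and let $f:E\to\mathbb{R}^m$ satisfy $$|f(x)-f(y)|\le c\,|x-y|^\alpha\qquad(x,y\in E),$$ where $c>0$ and $0<\alpha\le1$. Then $$\underline{\dim}_{\rm B} f(E)\le\frac1\alpha\,\underline{\dim}_{\rm B}^{\,m\alpha}E\quad\text{and}\quad \overline{\dim}_{\rm B} f(E)\le\frac1\alpha\,\overline{\dim}_{\rm B}^{\,m\alpha}E .$$
   Context: For $s>0$ and $r>0$ let $\phi_r^s(x)=\min\{1,(r/|x|)^s\}$ for $x\in\mathbb{R}^n$ (with $\phi_r^s(0)=1$). For non-empty compact $E\subset\mathbb{R}^n$ let $\mathcal{M}(E)$ be the set of Borel probability measures supported by $E$. The capacity $C_r^s(E)$ is defined by $$\frac{1}{C_r^s(E)}=\inf_{\mu\in\mathcal{M}(E)}\int\int\phi_r^s(x-y)\,d\mu(x)\,d\mu(y).$$ The lower and upper $s$-box dimension profiles of $E$ are $$\underline{\dim}_{\rm B}^{\,s}E=\liminf_{r\to0}\frac{\log C_r^s(E)}{-\log r},\qquad \overline{\dim}_{\rm B}^{\,s}E=\limsup_{r\to0}\frac{\log C_r^s(E)}{-\log r}.$$ For a non-empty compact set $A$ in a Euclidean space let $N_r(A)$ be the minimum number of sets of diameter $r$ that can cover $A$. The lower and upper box-counting dimensions of $A$ are $$\underline{\dim}_{\rm B}A=\liminf_{r\to0}\frac{\log N_r(A)}{-\log r},\qquad \overline{\dim}_{\rm B}A=\limsup_{r\to0}\frac{\log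 N_r(A)}{-\log r}.$$ *)

(* Defs.v *)
From mathcomp Require Import all_boot all_order all_algebra.
From mathcomp Require Import all_classical all_reals all_analysis.
Set Implicit Arguments.
Unset Strict Implicit.
Unset Printing Implicit Defensive.
Import Order.TTheory GRing.Theory Num.Theory.
Import numFieldNormedType.Exports.
Local Open Scope classical_set_scope.
Local Open Scope ring_scope.

(* Euclidean norm: the library norm on 'rV[R]_n is the sup norm.  Both induce
   the same topology, so [compact] and the Borel sets are the usual ones. *)
Definition enorm (R : realType) (n : nat) (x : 'rV[R]_n) : R :=
  Num.sqrt (\sum_(i < n) x ord0 i ^+ 2).

Definition borel_rV (R : realType) (n : nat) :=
  g_sigma_algebraType (@open 'rV[R]_n).

(* The case x = 0 is separate because r / 0 = 0 here. *)
Definition phi (R : realType) (n : nat) (s r : R) (x : 'rV[R]_n) : R :=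
  if x == 0 then 1 else Num.min 1 ((r / enorm x) `^ s).

Definition prob_on (R : realType) (n : nat) (E : set 'rV[R]_n) :
    set (probability (borel_rV R n) R) :=
  [set mu | mu (~` E) = 0%E].

Definition energy (R : realType) (n : nat) (s r : R)
    (mu : probability (borel_rV R n) R) : \bar R :=
  (\int[mu]_y \int[mu]_x (phi s r ((x : 'rV[R]_n) - (y : 'rV[R]_n)))%:E)%E.

(* For non-empty compact E and r, s > 0 the infimum is in ]0, 1], so that
   [fine] and the inverse are harmless. *)
Definition capacity (R : realType) (n : nat) (s r : R) (E : set 'rV[R]_n) : R :=
  (fine (ereal_inf [set energy s r mu | mu in prob_on E]))^-1.

Definition lower_dim_profile (R : realType) (n : nat) (s : R)
    (E : set 'rV[R]_n) : \bar R :=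
  limf_einf (fun r : R => (ln (capacity s r E) / - ln r)%:E) 0^'+.

Definition upper_dim_profile (R : realType) (n : nat) (s : R)
    (E : set 'rV[R]_n) : \bar R :=
  limf_esup (fun r : R => (ln (capacity s r E) / - ln r)%:E) 0^'+.

Definition diameter (R : realType) (m : nat) (U : set 'rV[R]_m) : \bar R :=
  ereal_sup [set (enorm (p.1 - p.2))%:E | p in U `*` U].

Definition coverable (R : realType) (m : nat) (r : R) (A : set 'rV[R]_m)
    (k : nat) : Prop :=
  exists U : 'I_k -> set 'rV[R]_m,
    (forall i, diameter (U i) = r%:E) /\ A `<=` \bigcup_i U i.

(* Least k such that A is coverable by k sets of diameter r; the default 0 is
   never used when A is compact, m > 0 and r > 0. *)
Definition covering_number (R : realType) (m : nat) (r : R)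
    (A : set 'rV[R]_m) : nat :=
  xget 0%N [set k | coverable r A k /\ forall j, coverable r A j -> (k <= j)%N].

Definition lower_box_dim (R : realType) (m : nat) (A : set 'rV[R]_m) : \bar R :=
  limf_einf (fun r : R => (ln (covering_number r A)%:R / - ln r)%:E) 0^'+.

Definition upper_box_dim (R : realType) (m : nat) (A : set 'rV[R]_m) : \bar R :=
  limf_esup (fun r : R => (ln (covering_number r A)%:R / - ln r)%:E) 0^'+.

(* Main.v *)
Require Import Defs.
From HB Require Import structures.
From mathcomp Require Import all_boot all_order all_algebra.
From mathcomp Require Import all_classical all_reals all_analysis.
From mathcomp Require Import measurable_realfun ring lra.
Import Order.TTheory GRing.Theory Num.Theory.
Import numFieldNormedType.Exports.
Local Open Scope classical_set_scope.
Local Open Scope ring_scope.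

Set Implicit Arguments.
Unset Strict Implicit.
Unset Printing Implicit Defensive.

(** Let [rho = c * r `^ alpha] and let [N] be the size of a maximal family of
    points [f (x_i)] of [f @` E] at mutual distance greater than a fixed
    multiple [d] of [rho].  Cubes of half-side [d] centred at these points cover
    [f @` E] and have diameter exactly [rho], so the covering number at scale
    [rho] is at most [N].

    A lower bound on the capacity is an upper bound on the least energy, hence
    any probability measure supported by [E] gives one.  The measure chosen here
    is the uniform one on the [x_i].  The Hoelder condition gives
    [phi (m * alpha) r (x_j - x_i) <= phi m rho (f x_j - f x_i)] ([phi_holder]).
    For a fixed [i], about [2 ^ (p * m)] of the separated points [f x_j] lie
    within [2 ^ p * d] of [f x_i], and on the corresponding dyadic shell
    [phi m rho] is about [2 ^ (- p * m)].  The exponent [m] is the one for which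
    the two factors cancel: every shell contributes a bounded amount
    ([sum_phi_separated]), and the number [q + 1] of shells needed to exhaust
    [f @` E] is of order [- ln r].  So the energy is at most [(q + 1) * K / N],
    that is, [N <= (q + 1) * K * capacity]
    ([covering_number_le_capacity]).

    After taking logarithms the factor [(q + 1) * K] is of order [ln (- ln r)],
    negligible against [- ln r], while [- ln rho] is equivalent to
    [alpha * - ln r]; this is where [1 / alpha] comes from.  The change of scale
    [r |-> c * r `^ alpha] preserves the filter [0^'+] in both directions, so
    the comparison passes to lower and to upper limits
    ([limf_einf_rescaled], [limf_esup_rescaled]). *)

(** * Separated families and covers by cubes *)

Lemma normr_rV_le (R : realType) (m : nat) (x : 'rV[R]_m) (d : R) :
  0 <= d -> (`|x| <= d) <-> (forall i, `|x ord0 i| <= d).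
Proof.
move=> d0; rewrite /Num.norm /= mx_normrE; split=> [/bigmax_leP [_ h] i|h].
  exact: (h (ord0, i)).
apply/bigmax_leP; split; first exact: d0.
by case=> i j _ /=; rewrite ord1; exact: h.
Qed.

Lemma coord_le_normr (R : realType) (m : nat) (x : 'rV[R]_m) i :
  `|x ord0 i| <= `|x|.
Proof. by move: i; apply/normr_rV_le. Qed.

Lemma enorm_ge0 (R : realType) (m : nat) (x : 'rV[R]_m) : 0 <= enorm x.
Proof. exact: sqrtr_ge0. Qed.

Lemma normr_le_enorm (R : realType) (m : nat) (x : 'rV[R]_m) : `|x| <= enorm x.
Proof.
apply/normr_rV_le=> [|i]; first exact: enorm_ge0.
rewrite -sqrtr_sqr ler_wsqrtr // (bigD1 i) //= lerDl.
by apply: sumr_ge0 => j _; exact: sqr_ge0.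
Qed.

Lemma enorm_le_normr (R : realType) (m : nat) (x : 'rV[R]_m) :
  enorm x <= Num.sqrt m%:R * `|x|.
Proof.
rewrite -[X in _ * X](ger0_norm (normr_ge0 x)) -sqrtr_sqr -sqrtrM //.
rewrite ler_wsqrtr //.
have -> : m%:R * `|x| ^+ 2 = \sum_(i < m) `|x| ^+ 2 :> R.
  by rewrite sumr_const card_ord mulr_natl.
apply: ler_sum => i _.
rewrite -(real_normK (num_real (x ord0 i))).
by rewrite lerXn2r ?nnegrE // coord_le_normr.
Qed.

Lemma enorm_eq0 (R : realType) (m : nat) (x : 'rV[R]_m) :
  (enorm x == 0) = (x == 0).
Proof.
apply/eqP/eqP=> [x0|->].
  by apply/eqP; rewrite -normr_eq0 eq_le normr_ge0 andbT -x0 normr_le_enorm.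
rewrite /enorm big1 ?sqrtr0 // => i _.
by rewrite mxE expr0n.
Qed.

(** The supremum is attained at opposite corners [z + d] and [z - d]; covers are
    made of sets whose diameter is prescribed exactly, so both inequalities
    matter. *)
Lemma diameter_cube (R : realType) (m : nat) (z : 'rV[R]_m) (d : R) :
  0 <= d ->
  diameter [set w | `|w - z| <= d] = (Num.sqrt m%:R * (2 * d))%:E.
Proof.
move=> d0; apply/eqP; rewrite eq_le; apply/andP; split.
  apply: ge_ereal_sup => _ [[u v] [/= uz vz] <-]; rewrite lee_fin /=.
  apply: (le_trans (enorm_le_normr _)); rewrite ler_wpM2l ?sqrtr_ge0 //.
  have -> : u - v = (u - z) - (v - z) by rewrite opprB addrA subrK.
  by apply: (le_trans (ler_normB _ _)); lra.
have norm_c : `|const_mx d : 'rV[R]_m| <= d.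
  by apply/normr_rV_le => // i; rewrite mxE ger0_norm.
apply: ereal_sup_ubound; exists (z + const_mx d, z - const_mx d).
  by split; rewrite /= addrAC subrr add0r ?normrN.
congr EFin => /=.
have -> : z + const_mx d - (z - const_mx d) = const_mx (2 * d) :> 'rV[R]_m.
  by apply/rowP=> i; rewrite !mxE; ring.
rewrite /enorm; under eq_bigr do rewrite mxE.
rewrite sumr_const card_ord -[_ ^+ 2 *+ m]mulr_natl sqrtrM //.
rewrite sqrtr_sqr ger0_norm //.
by rewrite mulr_ge0.
Qed.

Lemma covering_number_le (R : realType) (m : nat) (r : R) (A : set 'rV[R]_m) k :
  coverable r A k -> (covering_number r A <= k)%N.
Proof.
move=> cov; have ex : exists j, `[< coverable r A j >].
  by exists k; apply/asboolP.
have least : exists j, [set j | coverable r A j /\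
    forall i, coverable r A i -> (j <= i)%N] j.
  case: (ex_minnP ex) => j /asboolP covj minj.
  by exists j; split=> // i covi; apply: minj; apply/asboolP.
by have [_] := xgetPex 0%N least; apply.
Qed.

Definition separated (R : realType) (m : nat) (I : eqType) (d : R)
    (y : I -> 'rV[R]_m) :=
  forall i j, i != j -> d < `|y i - y j|.

(** Cut the space into half-open cubes of side [d], with the points
    [z - p * d] on the grid: two points in the same cube differ by less than [d]
    in each coordinate, so a separated family has at most one point per cube,
    and the ball of radius [p * d] meets [2 * p + 1] cubes in each
    direction. *)
Lemma card_separated (R : realType) (m : nat) (I : finType) (d : R)
    (y : I -> 'rV[R]_m) (z : 'rV[R]_m) (p : nat) (J : {set I}) :
  0 < d -> separated d y -> (forall i, i \in J -> `|y i - z| <= p%:R * d) ->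
  (#|J| <= (2 * p).+1 ^ m)%N.
Proof.
move=> d0 sep yz.
(* Shifting by [p] makes the grid coordinates non-negative, so that the cube
   indices are natural numbers. *)
pose t i l : R := (y i - z) ord0 l / d + p%:R.
have tP i l : i \in J -> 0 <= t i l <= (2 * p)%:R.
  move=> /yz yzi; have := le_trans (coord_le_normr (y i - z) l) yzi.
  rewrite ler_norml -mulNr -(ler_pdivrMr _ _ d0) -(ler_pdivlMr _ _ d0).
  by rewrite natrM /t => /andP[? ?]; apply/andP; split; lra.
pose g i : {ffun 'I_m -> 'I_(2 * p).+1} :=
  [ffun l => inord (Num.truncn (t i l))].
rewrite -(card_in_imset (f := g)); last first.
  move=> i j iJ jJ gij; apply/eqP; apply: contraT => /sep; rewrite ltNge.
  case/negP; apply/normr_rV_le; first exact: ltW.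
  move=> l; have /andP[i0 i2] := tP i l iJ; have /andP[j0 j2] := tP j l jJ.
  have := congr1 val (congr1 (fun h : {ffun _} => h l) gij).
  have tr u : 0 <= u -> u <= (2 * p)%:R :> R -> (Num.truncn u < (2 * p).+1)%N.
    move=> u0 u2; rewrite ltnS -(ler_nat R); apply: le_trans u2.
    by rewrite truncn_le.
  rewrite !ffunE /= !inordK ?tr // => tij.
  have := truncn_itv i0; have := truncn_itv j0.
  rewrite tij => /andP[a1 a2] /andP[b1 b2].
  have -> : (y i - y j) ord0 l = (t i l - t j l) * d.
    by rewrite /t !mxE; field; rewrite gt_eqF.
  rewrite normrM (gtr0_norm d0) ler_piMl ?ltW // ltr_norml.
  by move: a2 b2; rewrite -!natr1; lra.
apply: leq_trans (max_card _) _.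
by rewrite card_ffun !card_ord.
Qed.

(** A separated family in [F] that cannot be enlarged is a [d]-net; boundedness
    enters through [card_separated], which bounds the size of such
    families. *)
Lemma exists_separated_net (R : realType) (m : nat) (F : set 'rV[R]_m)
    (d B : R) :
  0 < d -> F !=set0 -> (forall z, F z -> `|z| <= B) ->
  exists k, exists y : 'I_k.+1 -> 'rV[R]_m,
    [/\ forall i, F (y i), separated d y &
        forall z, F z -> exists i, `|z - y i| <= d].
Proof.
move=> d0 [z0 Fz0] FB.
pose P k := `[< exists y : 'I_k.+1 -> 'rV[R]_m,
  (forall i, F (y i)) /\ separated d y >].
have exP : exists k, P k.
  exists 0%N; apply/asboolP; exists (fun=> z0); split=> // i j.
  by rewrite !ord1 eqxx.
pose p := (Num.truncn (B / d)).+1.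
have ubP k : P k -> (k <= (2 * p).+1 ^ m)%N.
  move=> /asboolP[y [Fy sep]].
  have := @card_separated R m _ d y 0 p [set: 'I_k.+1]%SET d0 sep _.
  rewrite cardsT card_ord => h; apply: ltnW; apply: h => i _.
  rewrite subr0; apply: le_trans (FB _ (Fy i)) _.
  by rewrite -ler_pdivrMr // ltW // truncnS_gt.
case: (ex_maxnP exP ubP) => k /asboolP[y [Fy sep]] maxk.
exists k, y; split=> // z Fz; apply: contrapT => far.
have {}far i : d < `|z - y i|.
  by rewrite ltNge; apply/negP => h; apply: far; exists i.
suff : P k.+1 by move=> /maxk; rewrite ltnn.
apply/asboolP; exists (fun i => if unlift ord0 i is Some j then y j else z).
split=> [i|i j]; first by case: unliftP.
case: unliftP => [i' ->|->]; case: unliftP => [j' ->|->].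
- by rewrite (inj_eq lift_inj) => /sep.
- by rewrite distrC.
- by [].
- by rewrite eqxx.
Qed.

Lemma coverable_net (R : realType) (m k : nat) (F : set 'rV[R]_m) (d : R)
    (y : 'I_k -> 'rV[R]_m) :
  0 <= d -> (forall z, F z -> exists i, `|z - y i| <= d) ->
  coverable (Num.sqrt m%:R * (2 * d)) F k.
Proof.
move=> d0 net; exists (fun i => [set w | `|w - y i| <= d]); split.
  by move=> i; exact: diameter_cube.
by move=> z /net[i zi]; exists i.
Qed.

(** * Energies and capacities *)

(** The integral of a non-negative function is a supremum over the simple
    functions below it, and [c] times the indicator of [A] is one of them.
    Monotonicity of the integral would ask for the measurability of [f]; the
    function of interest is the potential
    [fun y => \int[mu]_x phi s r (x - y)] of an arbitrary [mu]. *)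
Lemma integral_ge_cst_on d (T : measurableType d) (R : realType)
    (mu : {measure set T -> \bar R}) (A : set T) (c : R) (f : T -> \bar R) :
  measurable A -> 0 <= c -> (forall x, 0 <= f x)%E ->
  (forall x, A x -> c%:E <= f x)%E -> (c%:E * mu A <= \int[mu]_x f x)%E.
Proof.
move=> mA c0 f0 cf; rewrite ge0_integralTE //.
pose h := scale_nnsfun (indic_nnsfun R mA) c0.
apply: ereal_sup_ubound; exists h; rewrite /h /=.
  move=> x; rewrite mindicE.
  by case: (boolP (x \in A)); rewrite ?inE ?mulr1 ?mulr0 // => /cf.
rewrite -[LHS](integralT_nnsfun mu h) /=.
under eq_integral do rewrite EFinM.
rewrite ge0_integralZl //.
- by under eq_integral do rewrite mindicE;
    rewrite integral_indic // setIT.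
- by apply/measurable_EFinP.
- by move=> x _; rewrite lee_fin mindicE.
Qed.

Lemma continuous_measurable_borel (R : realType) (n : nat)
    (f : 'rV[R]_n -> R) :
  continuous f -> measurable_fun [set: borel_rV R n] (f : borel_rV R n -> R).
Proof.
move=> cf; apply: (measurability _ (RGenOInfty.measurableE R)).
move=> /= _ [_ [a ->]] <-; rewrite setTI preimage_itvoy.
apply: sub_sigma_algebra.
by apply: (open_comp _ (@open_gt _ _)) => x _; exact: cf.
Qed.

Lemma continuous_enorm (R : realType) (n : nat) : continuous (@enorm R n).
Proof.
have cont_sum : continuous (fun x : 'rV[R]_n => \sum_(i < n) x ord0 i ^+ 2).
  apply: continuous_big => [|i _ x]; first exact: add_continuous.
  apply: (@continuous_comp _ _ _
    (fun M : 'rV[R]_n => M ord0 i) (fun t => t ^+ 2)).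
    exact: coord_continuous.
  exact: exprn_continuous.
move=> x; apply: continuous_comp; first exact: cont_sum.
exact: sqrt_continuous.
Qed.

(** This form has no case distinction and no division by zero, which makes
    continuity and monotonicity in [enorm x] apparent. *)
Lemma phiE (R : realType) (n : nat) (s r : R) (x : 'rV[R]_n) :
  0 <= s -> 0 < r -> phi s r x = (r / Num.max r (enorm x)) `^ s.
Proof.
move=> s0 r0; have p1 : 1 `^ s = 1 :> R by rewrite powR1.
rewrite /phi -enorm_eq0; have := enorm_ge0 x.
rewrite le_eqVlt => /predU1P[<-|ex]; first by
  rewrite eqxx max_l ?ltW // divff ?gt_eqF // powR1.
rewrite gt_eqF //; case: (leP (enorm x) r) => [xr|rx].
  rewrite divff ?gt_eqF // powR1 min_l // -[leLHS]p1 ge0_ler_powR //.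
  - by rewrite nnegrE.
  - by rewrite nnegrE divr_ge0 // ltW.
  - by rewrite ler_pdivlMr // mul1r.
rewrite min_r // -[leRHS]p1 ge0_ler_powR // ?nnegrE //.
  by rewrite divr_ge0 // ltW.
by rewrite ler_pdivrMr // mul1r ltW.
Qed.

Lemma phi_ge0 (R : realType) (n : nat) (s r : R) (x : 'rV[R]_n) :
  0 <= phi s r x.
Proof. by rewrite /phi; case: ifP => // _; rewrite le_min ler01 powR_ge0. Qed.

Lemma phi_le1 (R : realType) (n : nat) (s r : R) (x : 'rV[R]_n) :
  phi s r x <= 1.
Proof. by rewrite /phi; case: ifP => // _; rewrite ge_min lexx. Qed.

(** The flag [b] covers both orders of subtraction: the inner integral of the
    energy runs over the left argument, the outer one over the right. *)
Lemma measurable_phi (R : realType) (n : nat) (s r : R) (y : 'rV[R]_n)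
    (b : bool) :
  0 <= s -> 0 < r ->
  measurable_fun [set: borel_rV R n]
    (fun x : borel_rV R n =>
       phi s r (if b then (x : 'rV[R]_n) - y else y - (x : 'rV[R]_n))).
Proof.
move=> s0 r0.
apply: (eq_measurable_fun (fun x : borel_rV R n => (r / Num.max r
  (enorm (if b then (x : 'rV[R]_n) - y else y - (x : 'rV[R]_n)))) `^ s)).
  by move=> x _; rewrite phiE.
suff cont : continuous (fun x : 'rV[R]_n =>
    r / Num.max r (enorm (if b then x - y else y - x))).
  exact: (measurableT_comp (measurable_powR s)
    (continuous_measurable_borel cont)).
have cont_r : continuous (fun t : R => r / Num.max r t).
  move=> t; apply: cvgM; first exact: cvg_cst.
  apply: cvgV; first by rewrite gt_eqF // lt_max r0.
  by apply: (@continuous_max _ _ (cst r) id t); [exact: cst_continuous|].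
have cont_b : continuous (fun x : 'rV[R]_n => if b then x - y else y - x).
  by case: b => x; apply: continuousB => //; exact: cst_continuous.
move=> x.
exact: (continuous_comp
  (continuous_comp (cont_b x) (@continuous_enorm _ _ _)) (cont_r _)).
Qed.

Section uniform_on.
Context d (T : measurableType d) (R : realType) (k : nat) (x : 'I_k.+1 -> T).

(** Points may repeat; [inord] only adapts the index type, since [msum] sums a
    sequence indexed by [nat]. *)
Definition uniform_on : set T -> \bar R :=
  mscale (k.+1%:R^-1)%:nng (msum (fun i => \d_(x (inord i))) k.+1).

HB.instance Definition _ := Measure.on uniform_on.

Lemma uniform_onE A :
  uniform_on A = ((k.+1%:R^-1)%:E * \sum_(i < k.+1) \d_(x i) A)%E.
Proof.
rewrite /uniform_on /mscale /= /msum; congr (_ * _)%E.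
by apply: eq_bigr => i _; rewrite inord_val.
Qed.

Let uniform_onT : uniform_on setT = 1%E.
Proof.
rewrite uniform_onE; under eq_bigr do rewrite diracT.
by rewrite sumEFin sumr_const card_ord -EFinM mulVf // pnatr_eq0.
Qed.

HB.instance Definition _ :=
  Measure_isProbability.Build _ _ R uniform_on uniform_onT.

Lemma integral_uniform_on (f : T -> \bar R) :
  (forall z, 0 <= f z)%E -> measurable_fun setT f ->
  (\int[uniform_on]_z f z = (k.+1%:R^-1)%:E * \sum_(i < k.+1) f (x i))%E.
Proof.
move=> f0 mf; rewrite ge0_integral_mscale //= ge0_integral_measure_sum //.
congr (_ * _)%E; apply: eq_bigr => i _.
by rewrite integral_dirac // diracT mul1e inord_val.
Qed.

End uniform_on.

Lemma energy_uniform_on (R : realType) (n k : nat) (s r : R)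
    (x : 'I_k.+1 -> 'rV[R]_n) : 0 <= s -> 0 < r ->
  energy s r (uniform_on R (x : 'I_k.+1 -> borel_rV R n)) =
    (k.+1%:R^-1 * \sum_(i < k.+1)
      (k.+1%:R^-1 * \sum_(j < k.+1) phi s r (x j - x i)))%:E.
Proof.
move=> s0 r0; rewrite /energy.
have inner (y : borel_rV R n) :
    (\int[uniform_on R (x : 'I_k.+1 -> borel_rV R n)]_z
      (phi s r ((z : 'rV[R]_n) - (y : 'rV[R]_n)))%:E)%E =
    (k.+1%:R^-1 * \sum_(j < k.+1) phi s r (x j - (y : 'rV[R]_n)))%:E.
  rewrite integral_uniform_on ?sumEFin //.
    by move=> z; rewrite lee_fin phi_ge0.
  by apply/measurable_EFinP; exact: (@measurable_phi _ _ _ _ _ true).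
under eq_integral do rewrite inner.
rewrite integral_uniform_on ?sumEFin //.
  move=> z; rewrite lee_fin mulr_ge0 // ?invr_ge0 //.
  by apply: sumr_ge0 => j _; exact: phi_ge0.
apply/measurable_EFinP; apply: measurable_funM => //.
apply: measurable_sum => j.
exact: (@measurable_phi _ _ _ _ _ false).
Qed.

(** Two points of [E] are at distance at most [D], so [phi] is bounded below
    on [E * E] by a positive constant independent of [mu]. *)
Lemma energy_ge (R : realType) (n : nat) (s r D : R) (E : set 'rV[R]_n)
    (mu : probability (borel_rV R n) R) :
  0 <= s -> 0 < r -> compact E ->
  (forall x y, E x -> E y -> enorm (x - y) <= D) -> prob_on E mu ->
  (((r / Num.max r D) `^ s)%:E <= energy s r mu)%E.
Proof.
move=> s0 r0 cE ED muE.
have mE : measurable (E : set (borel_rV R n)).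
  rewrite -[E]setCK; apply: measurableC; apply: sub_sigma_algebra.
  by rewrite /= openC; apply: compact_closed.
have muE1 : mu E = 1%E.
  have := probability_setC mu mE.
  rewrite muE => /esym/eqP; rewrite sube_eq // ?fin_num_measure // add0e.
  by move=> /eqP.
set c := (r / Num.max r D) `^ s.
have c0 : 0 <= c by exact: powR_ge0.
have pc x y : E x -> E y -> c <= phi s r (x - y).
  move=> Ex Ey; rewrite phiE // ge0_ler_powR //.
  - by rewrite nnegrE divr_ge0 ?le_max ?(ltW r0).
  - by rewrite nnegrE divr_ge0 ?le_max ?(ltW r0).
  - rewrite ler_wpM2l ?(ltW r0) // lef_pV2 ?posrE ?lt_max ?r0 //.
    by rewrite ge_max le_max lexx /= le_max ED // orbT.
have phi0 (x y : borel_rV R n) :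
  (0 <= (phi s r ((x : 'rV[R]_n) - (y : 'rV[R]_n)))%:E)%E.
  by rewrite lee_fin phi_ge0.
have mass_one (g : borel_rV R n -> \bar R) : (forall x, 0 <= g x)%E ->
    (forall x, E x -> c%:E <= g x)%E -> (c%:E <= \int[mu]_x g x)%E.
  by move=> g0 gc; rewrite -[leLHS]mule1 -muE1; exact: integral_ge_cst_on.
rewrite /energy; apply: (mass_one (fun y => \int[mu]_x _)%E) => [y|y Ey].
  exact: integral_ge0.
by apply: mass_one => // x Ex; rewrite lee_fin pc.
Qed.

Lemma compact_enorm_bounded (R : realType) (n : nat) (E : set 'rV[R]_n) :
  compact E -> exists D, forall x y, E x -> E y -> enorm (x - y) <= D.
Proof.
move=> cE; have [M [_ /(_ (M + 1)) EM]] := compact_bounded cE.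
have {}EM z : E z -> `|z| <= M + 1 by apply: EM; rewrite ltrDl.
exists (Num.sqrt n%:R * ((M + 1) + (M + 1))) => y z Ey Ez.
apply: le_trans (enorm_le_normr _) _; rewrite ler_wpM2l //.
by apply: le_trans (ler_normB _ _) _; rewrite lerD // EM.
Qed.

(** The uniform measure on the [x i] has energy at most [S / k.+1].
    Passing to inverses requires the infimum of the energies to be non-zero,
    which is the role of [energy_ge]. *)
Lemma capacity_ge (R : realType) (n k : nat) (s r S : R) (E : set 'rV[R]_n)
    (x : 'I_k.+1 -> 'rV[R]_n) :
  0 <= s -> 0 < r -> compact E -> (forall i, E (x i)) ->
  (forall i, \sum_(j < k.+1) phi s r (x j - x i) <= S) ->
  k.+1%:R / S <= capacity s r E.
Proof.
move=> s0 r0 cE Ex sumS.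
have [D ED] := compact_enorm_bounded cE.
pose mu : probability (borel_rV R n) R :=
  uniform_on R (x : 'I_k.+1 -> borel_rV R n).
have muE : prob_on E mu.
  rewrite /prob_on /= uniform_onE big1 ?mule0 // => i _.
  by rewrite diracE memNset //; apply; exact: Ex.
set I := ereal_inf [set energy s r mu | mu in prob_on E].
have I_le : (I <= (S / k.+1%:R)%:E)%E.
  apply: (@le_trans _ _ (energy s r mu)).
    by apply: ereal_inf_lbound; exists mu.
  rewrite energy_uniform_on // lee_fin mulrC ler_wpM2r ?invr_ge0 //.
  rewrite -mulr_sumr ler_pdivrMl ?ltr0n //.
  have -> : k.+1%:R * S = \sum_(i < k.+1) S.
    by rewrite sumr_const card_ord mulr_natl.
  exact: ler_sum.
set c := (r / Num.max r D) `^ s.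
have c0 : 0 < c by rewrite powR_gt0 // divr_gt0 // lt_max r0.
have I_ge : (c%:E <= I)%E.
  apply: le_ereal_inf_tmp => _ [nu nuE <-].
  exact: (energy_ge s0 r0 cE ED nuE).
have Ifin : I \is a fin_num.
  by rewrite fin_real // (lt_le_trans _ I_ge) ?ltNyr //
    (le_lt_trans I_le) ?ltry.
rewrite /capacity -/I.
move: I_le I_ge; rewrite -(fineK Ifin) !lee_fin => I_le I_ge.
have I0 := lt_le_trans c0 I_ge.
rewrite -[k.+1%:R / S]invrK invf_div lef_pV2 // posrE //.
exact: lt_le_trans I_le.
Qed.

(** * Kernel sums over separated families *)

(** Both sides are powers with exponent [m%:R], and the bases compare because
    the Hoelder bound says [max rho (enorm u) <= c * (max r (enorm w)) `^ alpha]
    for [rho = c * r `^ alpha]. *)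
Lemma phi_holder (R : realType) (n m : nat) (alpha c r : R)
    (w : 'rV[R]_n) (u : 'rV[R]_m) :
  0 < alpha -> 0 < c -> 0 < r -> enorm u <= c * enorm w `^ alpha ->
  phi (m%:R * alpha) r w <= phi m%:R (c * r `^ alpha) u.
Proof.
move=> a0 c0 r0 uw.
have ra0 : 0 < c * r `^ alpha by rewrite mulr_gt0 // powR_gt0.
have M0 : 0 < Num.max r (enorm w) by rewrite lt_max r0.
rewrite !phiE ?mulr_ge0 ?(ltW a0) // [m%:R * _]mulrC powRrM.
apply: ge0_ler_powR; rewrite ?nnegrE ?powR_ge0 //.
  by rewrite divr_ge0 ?le_max ?(ltW ra0).
rewrite ler_pdivlMr ?lt_max ?ra0 //.
have rE : (r / Num.max r (enorm w)) `^ alpha * Num.max r (enorm w) `^ alpha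
    = r `^ alpha.
  by rewrite -powRM ?divfK ?gt_eqF // ?divr_ge0 // ltW.
rewrite -[X in _ <= c * X]rE [leRHS]mulrCA ler_wpM2l ?powR_ge0 // ge_max.
apply/andP; split.
  rewrite ler_wpM2l ?(ltW c0) //.
  by rewrite ge0_ler_powR ?nnegrE ?(ltW a0) ?(ltW r0) ?(ltW M0) // le_max lexx.
apply: le_trans uw _; rewrite ler_wpM2l ?(ltW c0) //.
by rewrite ge0_ler_powR ?nnegrE ?(ltW a0) ?enorm_ge0 ?(ltW M0) //
  le_max lexx orbT.
Qed.

(** Dyadic summation.  The factor [q.+1] counts the ball of radius [d] at [z]
    and the shells between the radii [2 ^+ p.-1 * d] and [2 ^+ p * d] for
    [0 < p <= q].  On each of these pieces [phi] is at most
    [(4 * Num.sqrt m%:R / 2 ^+ p) ^+ m], and by [card_separated] the ball of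
    radius [2 ^+ p * d] contains at most [(3 * 2 ^+ p) ^+ m] of the points: the
    powers of [2 ^+ p] cancel. *)
Lemma sum_phi_separated (R : realType) (m k q : nat) (d : R)
    (y : 'I_k -> 'rV[R]_m) (z : 'rV[R]_m) :
  (0 < m)%N -> 0 < d -> separated d y -> (forall j, `|y j - z| <= 2 ^+ q * d) ->
  \sum_(j < k) phi m%:R (Num.sqrt m%:R * (2 * d)) (y j - z)
    <= q.+1%:R * (12 * Num.sqrt m%:R) ^+ m.
Proof.
move=> m0 d0 sep yz; set s := Num.sqrt m%:R; set rho := s * (2 * d).
have s1 : 1 <= s by rewrite -sqrtr1 ler_wsqrtr // ler1n.
have s0 : 0 < s by exact: lt_le_trans s1.
have rho0 : 0 < rho by rewrite !mulr_gt0.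
(* Replacing shells by balls only increases the bound and spares a partition
   of the points. *)
pose hit p j := (`|y j - z| <= 2 ^+ p * d).
have shell j : phi m%:R rho (y j - z) <=
    \sum_(p < q.+1) (hit p j)%:R * (4 * s / 2 ^+ p) ^+ m.
  have exhit : exists p, hit p j by exists q; exact: yz.
  (* The least such [p] says which shell contains [y j]. *)
  case: (ex_minnP exhit) => p hitp minp.
  have pq : (p < q.+1)%N by rewrite ltnS; apply: minp; exact: yz.
  have pos i : 0 <= (hit i j)%:R * (4 * s / 2 ^+ i) ^+ m.
    by rewrite mulr_ge0 // exprn_ge0 // divr_ge0 ?exprn_ge0 // mulr_ge0 // ltW.
  apply: (@le_trans _ _ ((hit p j)%:R * (4 * s / 2 ^+ p) ^+ m)); last first.
    rewrite (bigD1 (Ordinal pq)) //= lerDl.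
    by apply: sumr_ge0 => i _; exact: pos.
  rewrite hitp mul1r; case: p hitp minp pq {pos} => [|p] hitp minp pq.
    apply: le_trans (phi_le1 _ _ _) _; rewrite expr0 divr1.
    by apply: exprn_ege1; lra.
  have far : 2 ^+ p * d < `|y j - z|.
    by rewrite ltNge; apply/negP => /minp; rewrite ltnn.
  rewrite phiE // powR_mulrn ?divr_ge0 ?le_max ?(ltW rho0) //.
  apply: lerXn2r; rewrite ?nnegrE ?divr_ge0 ?le_max ?(ltW rho0) ?exprn_ge0 //.
    by rewrite mulr_ge0 // ltW.
  have M_ge : 2 ^+ p * d <= Num.max rho (enorm (y j - z)).
    by rewrite le_max (le_trans (ltW far) (normr_le_enorm _)) orbT.
  rewrite ler_pdivrMr ?lt_max ?rho0 //.
  apply: le_trans (ler_wpM2l _ M_ge); last first.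
    by rewrite divr_ge0 ?exprn_ge0 // mulr_ge0 // ltW.
  rewrite le_eqVlt; apply/orP; left; apply/eqP.
  by rewrite /rho exprS; field; rewrite expf_neq0.
apply: (@le_trans _ _ (\sum_(j < k) \sum_(p < q.+1)
    (hit p j)%:R * (4 * s / 2 ^+ p) ^+ m)); first exact: ler_sum.
rewrite exchange_big /=.
have -> : q.+1%:R * (12 * s) ^+ m = \sum_(p < q.+1) (12 * s) ^+ m.
  by rewrite sumr_const card_ord mulr_natl.
apply: ler_sum => p _; rewrite -mulr_suml.
have -> : \sum_(j < k) (hit p j)%:R = #|[set j | hit p j]%SET|%:R :> R.
  by rewrite -natr_sum -sum1_card [in RHS]big_mkcond /=; congr (_%:R);
    apply: eq_bigr => j _; rewrite inE; case: (hit p j).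
have card : (#|[set j | hit p j]%SET| <= (3 * 2 ^ p) ^ m)%N.
  apply: leq_trans (@card_separated _ _ _ d y z (2 ^ p) _ d0 sep _) _.
    by move=> i; rewrite inE /hit natrX.
  by rewrite leq_exp2r // mulSn -addn1 addnC leq_add2r expn_gt0.
have -> : 12 * s = (3 * 2 ^+ p) * (4 * s / 2 ^+ p).
  by field; rewrite expf_neq0.
rewrite [leRHS]exprMn ler_wpM2r //.
  by rewrite exprn_ge0 // divr_ge0 ?exprn_ge0 // mulr_ge0 // ltW.
by rewrite -natrX -natrM -natrX ler_nat.
Qed.

(** * Limits along a change of scale *)

(** Two intermediate reals rather than one leave room for the additive error
    [e] in the comparison of quotients. *)
Lemma ereal_two_between (R : realType) (x y : \bar R) : (x < y)%E ->
  exists v u : R, [/\ (x < v%:E)%E, v < u & (u%:E < y)%E].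
Proof.
case: x y => [x| |] [y| |] //= xy.
- rewrite lte_fin in xy; exists ((2 * x + y) / 3), ((x + 2 * y) / 3).
  by rewrite !lte_fin; split; lra.
- by exists (x + 1), (x + 2); rewrite lte_fin ltry; split=> //; lra.
- by exists (y - 2), (y - 1); rewrite lte_fin ltNyr; split=> //; lra.
- by exists 0, 1; rewrite ltNyr ltry ltr01.
Qed.

Lemma lt_of_mul_lt (R : realType) (alpha v : R) (L : \bar R) :
  0 < alpha -> ((1 / alpha)%:E * L < v%:E)%E -> (L < (alpha * v)%:E)%E.
Proof.
move=> a0; case: L => [L| |].
- by rewrite -EFinM !lte_fin mul1r mulrC ltr_pdivrMr // mulrC.
- by rewrite gt0_muley // lte_fin divr_gt0.
- by rewrite ltNyr.
Qed.

Lemma limf_esup_lt (R : realType) (b : R -> R) (F : set_system R)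
    {FF : Filter F} (M : R) :
  (limf_esup (fun r => (b r)%:E) F < M%:E)%E ->
  \forall r \near F, b r <= M.
Proof.
move=> /ereal_inf_lt[_ [A FA <-] AM].
apply: filterS FA => r Ar; rewrite -lee_fin (le_trans _ (ltW AM)) //.
by apply: ereal_sup_ubound; exists r.
Qed.

Lemma limf_esup_le (R : realType) (b : R -> R) (F : set_system R) (M : R) :
  (\forall r \near F, b r <= M) ->
  (limf_esup (fun r => (b r)%:E) F <= M%:E)%E.
Proof.
move=> bM; apply: ge_ereal_inf.
exists (ereal_sup [set (b r)%:E | r in [set r | b r <= M]]).
  by exists [set r | b r <= M].
by apply: ge_ereal_sup => _ [r rM <-]; rewrite lee_fin.
Qed.

Lemma limf_einf_gt (R : realType) (b : R -> R) (F : set_system R)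
    {FF : Filter F} (M : R) :
  (M%:E < limf_einf (fun r => (b r)%:E) F)%E ->
  \forall r \near F, M <= b r.
Proof.
rewrite /limf_einf lteNr => Mb.
have := @limf_esup_lt R (fun r => - b r) F FF (- M) Mb.
by apply: filterS => r; rewrite lerN2.
Qed.

Lemma limf_einf_ge (R : realType) (b : R -> R) (F : set_system R)
    {FF : Filter F} (M : R) :
  (\forall r \near F, M <= b r) ->
  (M%:E <= limf_einf (fun r => (b r)%:E) F)%E.
Proof.
move=> Mb; rewrite /limf_einf leeNr.
by apply: (@limf_esup_le R (fun r => - b r));
  apply: filterS Mb => r; rewrite lerN2.
Qed.

Lemma near_rescale (R : realType) (c alpha : R) (P : R -> Prop) :
  0 < c -> 0 < alpha -> (\forall t \near 0^'+, P t) ->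
  \forall r \near 0^'+, P (c * r `^ alpha).
Proof.
move=> c0 a0 [e /= e0 eP].
have e'0 : 0 < (e / c) `^ alpha^-1 by rewrite powR_gt0 // divr_gt0.
near=> r.
have r0 : 0 < r by near: r; exact: nbhs_right_gt.
have t0 : 0 < c * r `^ alpha by rewrite mulr_gt0 // powR_gt0.
apply: eP => //; rewrite /ball_ /= sub0r normrN gtr0_norm //.
rewrite mulrC -ltr_pdivlMr //.
have -> : e / c = ((e / c) `^ alpha^-1) `^ alpha.
  by rewrite -powRrM mulVf ?gt_eqF // powRr1 // divr_ge0 // ltW.
by rewrite gt0_ltr_powR ?nnegrE ?ltW.
Unshelve. all: by end_near. Qed.

(** The inverse of [r |-> c * r `^ alpha] is a map of the same kind, so the
    converse follows from the direct statement. *)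
Lemma near_rescaleV (R : realType) (c alpha : R) (P : R -> Prop) :
  0 < c -> 0 < alpha -> (\forall r \near 0^'+, P (c * r `^ alpha)) ->
  \forall t \near 0^'+, P t.
Proof.
move=> c0 a0 cP.
have d0 : 0 < (c^-1) `^ alpha^-1 by rewrite powR_gt0 // invr_gt0.
have aV0 : 0 < alpha^-1 by rewrite invr_gt0.
have := near_rescale d0 aV0 cP.
apply: filter_app; near=> t => Pt.
have t0 : 0 < t by near: t; exact: nbhs_right_gt.
suff -> : t = c * ((c^-1) `^ alpha^-1 * t `^ alpha^-1) `^ alpha by [].
rewrite -powRM ?invr_ge0 ?ltW // -powRrM mulVf ?gt_eqF // powRr1.
  by rewrite mulrA divff ?mul1r // gt_eqF.
by rewrite mulr_ge0 ?invr_ge0 // ltW.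
Unshelve. all: by end_near. Qed.

(** The hypothesis compares the quotients at corresponding scales pointwise,
    with a threshold [M] for [b] instead of [b r] itself: the error term depends
    on the size of [b r], which is not known to be bounded near [0].  The same
    implication serves both limits, directly for the upper one and by
    contraposition for the lower one. *)
Section rescaled_limits.
Context (R : realType) (a b : R -> R) (c alpha : R).
Hypotheses (c0 : 0 < c) (alpha0 : 0 < alpha).
Hypothesis ab : forall M e, 0 < e ->
  \forall r \near 0^'+, b r <= M -> a (c * r `^ alpha) <= M / alpha + e.

Lemma limf_esup_rescaled :
  (limf_esup (fun r => (a r)%:E) 0^'+
     <= (1 / alpha)%:E * limf_esup (fun r => (b r)%:E) 0^'+)%E.
Proof.
rewrite leNgt; apply/negP => /ereal_two_between[v [u [bv vu ua]]].
have /limf_esup_lt bM := lt_of_mul_lt alpha0 bv.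
have uv0 : 0 < u - v by rewrite subr_gt0.
suff : (limf_esup (fun r => (a r)%:E) 0^'+ <= u%:E)%E by rewrite leNgt ua.
apply: limf_esup_le; apply: (near_rescaleV c0 alpha0).
apply: filterS2 bM (ab (alpha * v) uv0) => r bM /(_ bM).
by rewrite mulrAC divff ?mul1r ?gt_eqF // addrCA subrr addr0.
Qed.

Lemma limf_einf_rescaled :
  (limf_einf (fun r => (a r)%:E) 0^'+
     <= (1 / alpha)%:E * limf_einf (fun r => (b r)%:E) 0^'+)%E.
Proof.
rewrite leNgt; apply/negP => /ereal_two_between[v [u [bv vu ua]]].
have uv0 : 0 < (u - v) / 2 by lra.
have ua' : \forall r \near 0^'+, u <= a (c * r `^ alpha).
  exact: (near_rescale c0 alpha0 (limf_einf_gt ua)).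
have := lt_of_mul_lt alpha0 bv; apply/negP; rewrite -leNgt.
apply: limf_einf_ge.
apply: filterS2 ua' (ab (alpha * v) uv0) => r ur abr.
rewrite leNgt; apply/negP => /ltW /abr.
rewrite mulrAC divff ?mul1r ?gt_eqF // => arv.
by have := le_trans ur arv; lra.
Qed.

End rescaled_limits.

Lemma near_Nln_ge (R : realType) (M : R) : \forall r \near 0^'+, M <= - ln r.
Proof.
near=> r.
have r0 : 0 < r by near: r; exact: nbhs_right_gt.
rewrite lerNr -(expRK (- M)) ler_ln ?posrE ?expR_gt0 //.
by near: r; apply: nbhs_right_le; exact: expR_gt0.
Unshelve. all: by end_near. Qed.

(** For [t > 0] one has [ln y = ln (y * t) - ln t < y * t - ln t]; a small [t]
    makes the slope at most [e / 2], and the other half of [e] absorbs the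
    constant. *)
Lemma near_ln_affine_le (R : realType) (A B e : R) :
  0 < A -> 0 < B -> 0 < e ->
  \forall r \near 0^'+, ln (A + B * - ln r) <= e * - ln r.
Proof.
move=> A0 B0 e0; pose t := e / (2 * B).
have t0 : 0 < t by rewrite divr_gt0 // mulr_gt0.
near=> r.
have l0 : 0 <= - ln r by near: r; exact: near_Nln_ge.
have lbig : (A * t - ln t) / (e / 2) <= - ln r by near: r; exact: near_Nln_ge.
set l := - ln r in l0 lbig *.
have y0 : 0 < A + B * l by rewrite ltr_wpDr // mulr_ge0 // ltW.
rewrite ler_pdivrMr ?divr_gt0 // in lbig.
have := ln_sublinear (mulr_gt0 y0 t0); rewrite lnM ?posrE // => lny.
have tE : B * t = e / 2 by rewrite /t; field; rewrite gt_eqF.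
have : (A + B * l) * t = A * t + l * (e / 2) by rewrite -tE; ring.
lra.
Unshelve. all: by end_near. Qed.

(** * Images under Hoelder maps *)

Section holder_image.
Context (R : realType) (n m : nat) (E : set 'rV[R]_n)
  (f : 'rV[R]_n -> 'rV[R]_m).
Context (c alpha : R).
Hypotheses (m0 : (0 < m)%N) (E0 : E !=set0) (cE : compact E).
Hypotheses (c0 : 0 < c) (alpha0 : 0 < alpha).
Hypothesis holder_f : forall x y : 'rV[R]_n, E x -> E y ->
  enorm (f x - f y) <= c * enorm (x - y) `^ alpha.

(** The inequality [1 <= C] keeps the logarithm of [C] non-negative, so that
    taking logarithms is harmless. *)
Lemma covering_number_le_capacity : exists K D : R, [/\ 0 < K, 0 < D &
  forall (r : R) (q : nat), 0 < r -> D <= 2 ^+ q * (c * r `^ alpha) ->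
    let C := q.+1%:R * K * capacity (m%:R * alpha) r E in
    1 <= C /\ (covering_number (c * r `^ alpha) (f @` E))%:R <= C].
Proof.
have [D0 ED0] := compact_enorm_bounded cE.
pose B := c * D0 `^ alpha.
have fB x y : E x -> E y -> `|f x - f y| <= B.
  move=> Ex Ey; apply: le_trans (normr_le_enorm _) _.
  apply: le_trans (holder_f Ex Ey) _; rewrite ler_wpM2l ?(ltW c0) //.
  by rewrite ge0_ler_powR ?nnegrE ?(ltW alpha0) ?enorm_ge0 ?ED0 //
    (le_trans (enorm_ge0 (x - y))) ?ED0.
have s1 : 1 <= Num.sqrt m%:R :> R by rewrite -[leLHS]sqrtr1 ler_wsqrtr // ler1n.
have s0 : 0 < Num.sqrt m%:R :> R by exact: lt_le_trans s1.
have B0 : 0 <= B by rewrite mulr_ge0 ?powR_ge0 ?(ltW c0).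
(* The threshold on [q] says that [f @` E] lies within [2 ^+ q * d] of each of
   its points, for the [d] below; the [+ 1] makes it positive when [B = 0]. *)
exists ((12 * Num.sqrt m%:R) ^+ m), (2 * Num.sqrt m%:R * (B + 1)).
split=> [||r q r0 Dq].
- by rewrite exprn_gt0 // mulr_gt0.
- by rewrite !mulr_gt0 //; lra.
set C := _ * capacity _ _ _.
have rho0 : 0 < c * r `^ alpha by rewrite mulr_gt0 // powR_gt0.
(* Cubes of half-side [d] have diameter [c * r `^ alpha]. *)
pose d := c * r `^ alpha / (2 * Num.sqrt m%:R).
have d0 : 0 < d by rewrite divr_gt0 // mulr_gt0.
have rhoE : c * r `^ alpha = Num.sqrt m%:R * (2 * d).
  by rewrite /d; field; rewrite gt_eqF.
have [x0 Ex0] := E0.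
have [k [y [Fy sep net]]] : exists k, exists y : 'I_k.+1 -> 'rV[R]_m,
    [/\ forall i, (f @` E) (y i), separated d y &
        forall z, (f @` E) z -> exists i, `|z - y i| <= d].
  apply: (@exists_separated_net _ _ _ _ (`|f x0| + B)) => //.
    by exists (f x0), x0.
  move=> _ [x Ex <-]; rewrite -[f x](subrK (f x0)) addrC.
  by apply: le_trans (ler_normD _ _) _; rewrite lerD2l fB.
have /choice[x xP] : forall i, exists x, E x /\ f x = y i.
  by move=> i; have [x Ex fx] := Fy i; exists x.
have k_le : k.+1%:R <= C.
  rewrite /C -ler_pdivrMl; last by rewrite mulr_gt0 // exprn_gt0 // mulr_gt0.
  rewrite mulrC; apply: capacity_ge (fun i => (xP i).1) _ => //.
    by rewrite mulr_ge0 // ltW.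
  move=> i.
  apply: le_trans (sum_phi_separated (q := q) (z := y i) m0 d0 sep _).
    apply: ler_sum => j _; rewrite -rhoE; apply: phi_holder => //.
    by rewrite -(xP i).2 -(xP j).2;
      apply: holder_f; [exact: (xP j).1|exact: (xP i).1].
  move=> j; rewrite -(xP i).2 -(xP j).2.
  apply: le_trans (fB _ _ (xP j).1 (xP i).1) _.
  apply: le_trans (_ : B + 1 <= _); first by rewrite lerDl.
  by rewrite /d mulrA ler_pdivlMr ?mulr_gt0 // mulrC.
split; first by apply: le_trans k_le; rewrite ler1n.
apply: le_trans k_le; rewrite ler_nat.
by rewrite rhoE; apply: covering_number_le; exact: coverable_net (ltW d0) net.
Qed.

(** The number [q] of shells must be at least the logarithm to base [2] of
    [D / (c * r `^ alpha)], which is affine in [- ln r].  In [a0] the constant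
    [ln (D / c)] is replaced by its absolute value, so that the quantity rounded
    to a natural number is non-negative. *)
Lemma box_quotient_le_profile_quotient (M e : R) : 0 < e ->
  \forall r \near 0^'+,
    ln (capacity (m%:R * alpha) r E) / - ln r <= M ->
    ln (covering_number (c * r `^ alpha) (f @` E))%:R / - ln (c * r `^ alpha)
      <= M / alpha + e.
Proof.
move=> e0; have [K [D [K0 D0 cov]]] := covering_number_le_capacity.
have ln2 : 0 < ln 2 :> R by rewrite ln_gt0 // ltr1n.
pose a0 := `|ln (D / c)| / ln 2; pose a1 := alpha / ln 2.
have a0_ge0 : 0 <= a0 by rewrite divr_ge0 // ltW.
have a1_gt0 : 0 < a1 by rewrite divr_gt0.
have A0 : 0 < (a0 + 2) * K by rewrite mulr_gt0 //; lra.
have B0 : 0 < a1 * K by rewrite mulr_gt0.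
have e'0 : 0 < e * alpha / 2 by rewrite !mulr_gt0.
(* [lc] makes [- ln (c * r `^ alpha)] positive; [lM] and [lln] each allot half
   of the error [e * alpha * - ln r], to the constant [c] and to the number of
   shells. *)
near=> r => CM.
have r0 : 0 < r by near: r; exact: nbhs_right_gt.
have l1 : 1 <= - ln r by near: r; exact: near_Nln_ge.
have lc : (`|ln c| + 1) / alpha <= - ln r by near: r; exact: near_Nln_ge.
have lM : (M / alpha + e) * ln c / (e * alpha / 2) <= - ln r.
  by near: r; exact: near_Nln_ge.
have lln : ln ((a0 + 2) * K + a1 * K * - ln r) <= e * alpha / 2 * - ln r.
  by near: r; exact: near_ln_affine_le.
set l := - ln r in CM l1 lc lM lln.
have ra0 : 0 < r `^ alpha by exact: powR_gt0.
have lrho : - ln (c * r `^ alpha) = alpha * l - ln c.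
  by rewrite lnM ?posrE // ln_powR /l; ring.
have lrho0 : 0 < alpha * l - ln c.
  rewrite ler_pdivrMr // in lc; have := ler_norm (ln c); lra.
pose q := (Num.truncn (a0 + a1 * l)).+1.
have t0 : 0 <= a0 + a1 * l.
  by rewrite addr_ge0 // mulr_ge0 ?(ltW a1_gt0) // (le_trans _ l1).
have Dq : D <= 2 ^+ q * (c * r `^ alpha).
  rewrite mulrA [2 ^+ q * c]mulrC -mulrA -ler_pdivrMl // mulrC.
  rewrite -ler_pdivrMr // -ler_ln ?posrE ?divr_gt0 ?exprn_gt0 //.
  rewrite lnXn // ln_div ?posrE ?divr_gt0 // ln_powR -[leRHS]mulr_natl.
  have : a0 + a1 * l <= q%:R by apply/ltW/truncnS_gt.
  rewrite -(ler_pM2r ln2) mulrDl /a0 /a1 divfK ?gt_eqF //.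
  rewrite [alpha / _ * l]mulrAC divfK ?gt_eqF // => h.
  have := ler_norm (ln (D / c)); rewrite /l in h; lra.
have [C1 NC] := cov r q r0 Dq.
have qK0 : 0 < q.+1%:R * K by rewrite mulr_gt0.
have cap0 : 0 < capacity (m%:R * alpha) r E.
  by rewrite -(pmulr_rgt0 _ qK0); exact: lt_le_trans C1.
have qK : q.+1%:R * K <= (a0 + 2) * K + a1 * K * l.
  have -> : (a0 + 2) * K + a1 * K * l = (a0 + 2 + a1 * l) * K by ring.
  rewrite ler_pM2r // /q -natr1 -natr1 -[leLHS]addrA [leRHS]addrAC.
  by apply: lerD => //; rewrite truncn_le.
have lnN : ln (covering_number (c * r `^ alpha) (f @` E))%:R
    <= ln (q.+1%:R * K) + ln (capacity (m%:R * alpha) r E).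
  rewrite -lnM ?posrE //.
  case: (posnP (covering_number (c * r `^ alpha) (f @` E))) => [->|N0].
    by rewrite ln0 // ln_ge0.
  by rewrite ler_ln ?posrE ?ltr0n // (lt_le_trans _ C1).
rewrite ler_pdivrMr ?(lt_le_trans _ l1) // in CM.
rewrite lrho ler_pdivrMr //.
have lnqK : ln (q.+1%:R * K) <= e * alpha / 2 * l.
  by apply: le_trans lln; rewrite ler_ln ?posrE // (lt_le_trans qK0).
rewrite ler_pdivrMr // in lM.
have -> : (M / alpha + e) * (alpha * l - ln c) =
    M * l + e * alpha * l - (M / alpha + e) * ln c.
  by field; rewrite gt_eqF.
apply: le_trans lnN _; clear -CM lM lnqK; lra.
Unshelve. all: by end_near. Qed.

End holder_image.

Unset Implicit Arguments.

Theorem theorem2p6 (R : realType) (n m : nat) (hn : (0 < n)%N) (hm : (0 < m)%N)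
    (E : set 'rV[R]_n) (hE0 : E !=set0) (hEc : compact E)
    (f : 'rV[R]_n -> 'rV[R]_m) (c alpha : R) (hc : 0 < c)
    (halpha0 : 0 < alpha) (halpha1 : alpha <= 1)
    (hf : forall x y : 'rV[R]_n, E x -> E y ->
      enorm (f x - f y) <= c * enorm (x - y) `^ alpha) :
  (lower_box_dim (f @` E)
     <= (1 / alpha)%:E * lower_dim_profile (m%:R * alpha) E)%E /\
  (upper_box_dim (f @` E)
     <= (1 / alpha)%:E * upper_dim_profile (m%:R * alpha) E)%E.
Proof.
have key := box_quotient_le_profile_quotient hm hE0 hEc hc halpha0 hf.
split.
- exact: (@limf_einf_rescaled _
    (fun t => ln (covering_number t (f @` E))%:R / - ln t)
    _ _ _ hc halpha0 key).
- exact: (@limf_esup_rescaled _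
    (fun t => ln (covering_number t (f @` E))%:R / - ln t)
    _ _ _ hc halpha0 key).
Qed.
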